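(* The Neumann-Dirichlet algorithm ND$_1$ (with relaxation parameter $\theta\in(0,1)$) converges for all initial guesses if $\gamma=0$ and the matrix $A$ is not singular.
   Context: Let $A\in\mathbb{R}^{n\times n}$ be a diagonalizable matrix (for instance symmetric), $A=PDP^{-1}$ with $D=\mathrm{diag}(d_1,\dots,d_n)$, where $d_i$ are the eigenvalues of $A$; $A$ replaces the spatial operator $-\Delta$ after a semi-discretization in space (e.g. by finite differences) of a parabolic optimal control problem. Let $\nu>0$, $\gamma\ge 0$, $T>0$, and let the time interval $(0,T)$ be decomposed into $\Omega_1=(0,\alpha)$ and $\Omega_2=(\alpha,T)$ with interface $0<\alpha<T$. Algorithm ND$_1$ (error equations) with relaxation parameter $\theta\in(0,1)$: for each $i=1,\dots,n$, given an initial guess $f_i^0$, for $k=1,2,\dots$: (1) solve $\dot z_{2,i}^k+d_iz_{2,i}^k-\nu^{-1}\mu_{2,i}^k=0$, $\dot\mu_{2,i}^k-z_{2,i}^k-d_i\mu_{2,i}^k=0$ in $\Omega_2$ with $z_{2,i}^k(\alpha)=f_i^{k-1}$, $\mu_{2,i}^k(T)+\gamma z_{2,i}^k(T)=0$; (2) solve $\dot z_{1,i}^k+d_iz_{1,i}^k-\nu^{-1}\mu_{1,i}^k=0$, $\dot\mu_{1,i}^k-z_{1,i}^k-d_i\mu_{1,i}^k=0$ in $\Omega_1$ with $z_{1,i}^k(0)=0$, $\dot\mu_{1,i}^k(\alpha)=\dot\mu_{2,i}^k(\alpha)$; (3) set $f_i^k=(1-\theta)f_i^{k-1}+\theta z_{1,i}^k(\alpha)$.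 The algorithm converges for all initial guesses if $f_i^k\to 0$ as $k\to\infty$ for every $i$ and every initial guess $(f_1^0,\dots,f_n^0)$.
   Formalization: The eigenvalues d_i of A are assumed nonnegative (as for a discretized −Δ); without this the claim fails, e.g. for n=1, d=−1, ν=1, γ=0 and α with coth(√2 α)=1.4, where the iteration diverges for every θ in (0,1). *)

(* Defs.v *)
From HB Require Import structures.
From mathcomp Require Import all_boot all_order all_algebra.
From mathcomp Require Import all_classical all_reals all_analysis.
Set Implicit Arguments.
Unset Strict Implicit.
Unset Printing Implicit Defensive.
Import Order.TTheory GRing.Theory Num.Theory.
Import numFieldNormedType.Exports.
Local Open Scope classical_set_scope.
Local Open Scope ring_scope.

(* Classical solutions of the scalar forward-backward system on ]a, b[; the
   functions live on R but only their values on [a, b] are constrained, and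
   [derivable_oo_LRcontinuous] makes the boundary values z a, z b meaningful. *)
Definition optimality_system (R : realType) (nu d a b : R) (z mu : R -> R) :
    Prop :=
  [/\ derivable_oo_LRcontinuous z a b,
      derivable_oo_LRcontinuous mu a b &
      forall t : R, a < t < b ->
        (z^`()%classic t : R) + d * z t - nu^-1 * mu t = 0 /\
        (mu^`()%classic t : R) - z t - d * mu t = 0].

Definition left_derivative (R : realType) (g : R -> R) (x l : R) : Prop :=
  (fun h : R => h^-1 * (g (x + h) - g x)) @ 0^'- --> l.

Definition right_derivative (R : realType) (g : R -> R) (x l : R) : Prop :=
  (fun h : R => h^-1 * (g (x + h) - g x)) @ 0^'+ --> l.

(* One iteration, for one eigenvalue d, from the interface value f to f'. The
   functions z1, mu1 live on [0, alpha] and z2, mu2 on [alpha, T], so the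
   transmission condition compares one-sided derivatives at alpha. *)
Definition nd1_step (R : realType) (nu gamma T alpha theta d f f' : R) : Prop :=
  exists z1 mu1 z2 mu2 : R -> R,
  [/\ [/\ optimality_system nu d alpha T z2 mu2,
          z2 alpha = f &
          mu2 T + gamma * z2 T = 0],
      [/\ optimality_system nu d 0 alpha z1 mu1,
          z1 0 = 0 &
          exists l : R, left_derivative mu1 alpha l /\
                        right_derivative mu2 alpha l] &
      f' = (1 - theta) * f + theta * z1 alpha].

Definition nd1_run (R : realType) (n : nat) (nu gamma T alpha theta : R)
    (d : 'rV[R]_n) (f0 : 'rV[R]_n) (f : nat -> 'rV[R]_n) : Prop :=
  f 0%N = f0 /\
  forall (k : nat) (i : 'I_n),
    nd1_step nu gamma T alpha theta (d 0 i) (f k 0 i) (f k.+1 0 i).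

(* Solvability of all the subproblems is part of convergence: without the
   first conjunct the property would hold vacuously for an algorithm that
   breaks down. *)
Definition nd1_converges (R : realType) (n : nat) (nu gamma T alpha theta : R)
    (d : 'rV[R]_n) : Prop :=
  forall f0 : 'rV[R]_n,
    (exists f : nat -> 'rV[R]_n, nd1_run nu gamma T alpha theta d f0 f) /\
    (forall f : nat -> 'rV[R]_n, nd1_run nu gamma T alpha theta d f0 f ->
       forall i : 'I_n, (fun k : nat => f k 0 i) @ \oo --> (0 : R)).

(* Main.v *)
Require Import Defs.
From HB Require Import structures.
From mathcomp Require Import all_boot all_order all_algebra.
From mathcomp Require Import all_classical all_reals all_analysis.
From mathcomp Require Import ring lra.
Set Implicit Arguments.
Unset Strict Implicit.
Unset Printing Implicit Defensive.
Import Order.TTheory GRing.Theory Num.Theory.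
Import numFieldNormedType.Exports.
Local Open Scope classical_set_scope.
Local Open Scope ring_scope.

(* With s = sqrt (d^2 + 1/nu), both combinations z + (k + d) mu, k = s or -s,
   solve w' = k w, so every solution of the optimality system is
     mu = c1 e^(st) + c2 e^(-st),  z = c1 (s - d) e^(st) - c2 (s + d) e^(-st).
   Solving for the constants turns one iteration into multiplication by
   1 - theta + theta r with
     r = 1 / (nu (s + d coth (s alpha)) (s + d tanh (s (T - alpha)))),
   and 0 <= r < 1 / (nu s^2) < 1 when d > 0. The eigenvalue d = 0 would give
   r = 1, which is why A has to be nonsingular. *)

(** * Regularity up to the endpoints and the scalar equation [w' = k w] *)

Lemma derivable_oo_LRcontinuousM (R : realType) (f g : R -> R) (a b : R) :
  derivable_oo_LRcontinuous f a b -> derivable_oo_LRcontinuous g a b ->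
  derivable_oo_LRcontinuous (f \* g) a b.
Proof.
move=> [df fa fb] [dg ga gb]; split; [|exact: cvgM..].
by move=> x xab; apply: derivableM; [exact: df|exact: dg].
Qed.

Lemma derivable_oo_LRcontinuousD (R : realType) (f g : R -> R) (a b : R) :
  derivable_oo_LRcontinuous f a b -> derivable_oo_LRcontinuous g a b ->
  derivable_oo_LRcontinuous (f \+ g) a b.
Proof.
move=> [df fa fb] [dg ga gb]; split; [|exact: cvgD..].
by move=> x xab; apply: derivableD; [exact: df|exact: dg].
Qed.

Lemma derivable_oo_LRcontinuousW (R : realType) (f : R -> R) (a b : R) :
  (forall x, derivable f x 1) -> derivable_oo_LRcontinuous f a b.
Proof.
move=> df.
have cf x : {for x, continuous f}.
  by apply/differentiable_continuous/derivable1_diffP.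
split=> [x _||]; first exact: df.
- by apply: cvg_at_right_filter; exact: cf.
- by apply: cvg_at_left_filter; exact: cf.
Qed.

Lemma is_derive_expRM (R : realType) (k x : R) :
  is_derive x 1 (fun t => expR (k * t)) (k * expR (k * x)).
Proof.
apply: (trigger_derive (x1 := expR (k * x) * (k * 1))).
by rewrite mulr1 mulrC.
Qed.

(** The product [w t * expR (- k * t)] has zero derivative inside the interval and is continuous up
    to its ends, so the mean value theorem makes it constant. *)
Lemma linear_ode_sol (R : realType) (k a b : R) (w : R -> R) :
  derivable_oo_LRcontinuous w a b ->
  (forall t, a < t < b -> w^`()%classic t = k * w t) ->
  exists c, forall t, a <= t <= b -> w t = c * expR (k * t).
Proof.
move=> dw w'; pose g := w \* (fun t => expR (- k * t)).
exists (g a) => t /andP[at_ tb].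
have dg : derivable_oo_LRcontinuous g a b.
  apply: derivable_oo_LRcontinuousM => //.
  by apply: derivable_oo_LRcontinuousW => x; have [] := is_derive_expRM (- k) x.
have cg : {within `[a, t], continuous g}.
  apply: continuous_subspaceW (derivable_oo_LRcontinuous_within dg).
  by move=> x /=; rewrite !in_itv/= => /andP[-> /le_trans ->].
have g' x : x \in `]a, t[ -> is_derive x 1 g ((fun _ => 0) x).
  rewrite in_itv/= => /andP[ax xt].
  have xab : a < x < b by rewrite ax (lt_le_trans xt).
  have [dwx _ _] := dw.
  have /derivableP : derivable w x 1 by apply: dwx; rewrite in_itv.
  rewrite -derive1E w'// => wx; have ex := is_derive_expRM (- k) x.
  apply: (trigger_derive (is_deriveM wx ex : is_derive x 1 g _)).
  by rewrite /GRing.scale/=; ring.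
have [c _ /eqP] := MVT_segment at_ g' cg.
rewrite mul0r subr_eq0 => /eqP <-.
by rewrite /g/= -mulrA -expRD mulNr addNr expR0 mulr1.
Qed.

(** * Closed form of the solutions of the optimality system *)

Definition costate (R : realType) (s c1 c2 t : R) : R :=
  c1 * expR (s * t) + c2 * expR (- s * t).

(** This is [mu' - d mu] for [mu = costate s c1 c2], the form that the second equation imposes on
    [z]. *)
Definition state (R : realType) (d s c1 c2 t : R) : R :=
  c1 * (s - d) * expR (s * t) - c2 * (s + d) * expR (- s * t).

Lemma is_derive_costate (R : realType) (s c1 c2 t : R) :
  is_derive t 1 (costate s c1 c2) (costate s (s * c1) (- s * c2) t).
Proof.
have e1 := is_derive_expRM s t; have e2 := is_derive_expRM (- s) t.
apply: (trigger_derive (is_deriveD (is_deriveZ c1 e1) (is_deriveZ c2 e2) :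
  is_derive t 1 (costate s c1 c2) _)).
by rewrite /costate /GRing.scale/=; ring.
Qed.

(** Lets [is_derive_costate] differentiate states as well. *)
Lemma stateE (R : realType) (d s c1 c2 : R) :
  state d s c1 c2 = costate s (c1 * (s - d)) (- (c2 * (s + d))).
Proof. by apply/funext => t; rewrite /state /costate; ring. Qed.

Lemma optimality_system_state (R : realType) (nu d s a b c1 c2 : R) :
  s ^+ 2 = d ^+ 2 + nu^-1 ->
  optimality_system nu d a b (state d s c1 c2) (costate s c1 c2).
Proof.
move=> sE; rewrite stateE; split.
- apply: derivable_oo_LRcontinuousW => x.
  exact: (@ex_derive _ _ _ _ _ _ _ (is_derive_costate _ _ _ _)).
- apply: derivable_oo_LRcontinuousW => x.
  exact: (@ex_derive _ _ _ _ _ _ _ (is_derive_costate _ _ _ _)).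
- move=> t _; rewrite !derive1E.
  rewrite (@derive_val _ _ _ _ _ _ _ (is_derive_costate _ _ _ _)).
  rewrite (@derive_val _ _ _ _ _ _ _ (is_derive_costate s c1 c2 t)) /costate.
  have -> : nu^-1 = s ^+ 2 - d ^+ 2 by rewrite sE; ring.
  by split; ring.
Qed.

Lemma optimality_system_sol (R : realType) (nu d s a b : R) (z mu : R -> R) :
  s != 0 -> s ^+ 2 = d ^+ 2 + nu^-1 -> optimality_system nu d a b z mu ->
  exists c1 c2, forall t, a <= t <= b ->
    z t = state d s c1 c2 t /\ mu t = costate s c1 c2 t.
Proof.
move=> s0 sE [dz dmu ode].
(* Used for [k = s] and [k = - s]: the system gives [z' + (k + d) mu' = k z + (nu^-1 + k d + d^2)
   mu], and [nu^-1 = k^2 - d^2] turns the last coefficient into [k (k + d)]. *)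
have eig k : k ^+ 2 = s ^+ 2 -> exists c, forall t, a <= t <= b ->
    z t + (k + d) * mu t = c * expR (k * t).
  move=> kE; apply: (@linear_ode_sol _ k a b (z \+ (cst (k + d) \* mu))).
    apply: derivable_oo_LRcontinuousD => //.
    apply: derivable_oo_LRcontinuousM => //.
    by apply: derivable_oo_LRcontinuousW => x; exact: derivable_cst.
  move=> t tab; have [dz' _ _] := dz; have [dmu' _ _] := dmu.
  have tI : t \in `]a, b[ by rewrite in_itv.
  have [/eqP + /eqP] := ode t tab.
  rewrite !derive1E => z' mu'.
  have Hz := derivableP (dz' t tI); have Hmu := derivableP (dmu' t tI).
  have /= H := is_deriveD Hz (is_deriveZ (k + d) Hmu).
  rewrite [LHS](@derive_val _ _ _ _ _ _ _ H) /GRing.scale/=.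
  have -> : 'D_1 z t = nu^-1 * mu t - d * z t.
    by move: z'; rewrite subr_eq0 addrC => /eqP <-; ring.
  have -> : 'D_1 mu t = z t + d * mu t.
    by move: mu'; rewrite subr_eq0 subr_eq => /eqP ->; ring.
  have -> : nu^-1 = k ^+ 2 - d ^+ 2 by rewrite kE sE; ring.
  by ring.
have [p hp] := eig s erefl.
have [q hq] := eig (- s) (sqrrN s).
(* On the closed form the two combinations equal [2 s c1 e^(st)] and [- 2 s c2 e^(-st)]. *)
exists (p / (2 * s)), (- q / (2 * s)) => t tab.
rewrite /state /costate.
have -> : p / (2 * s) * (s - d) * expR (s * t) =
  (z t + (s + d) * mu t) * (s - d) / (2 * s) by rewrite hp//; ring.
have -> : - q / (2 * s) * (s + d) * expR (- s * t) =
  - (z t + (- s + d) * mu t) * (s + d) / (2 * s) by rewrite hq//; ring.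
have -> : p / (2 * s) * expR (s * t) = (z t + (s + d) * mu t) / (2 * s).
  by rewrite hp//; ring.
have -> : - q / (2 * s) * expR (- s * t) = - (z t + (- s + d) * mu t) / (2 * s).
  by rewrite hq//; ring.
by split; field.
Qed.

(** * One-sided derivatives at the interface *)

Lemma is_derive1_cvg (R : realType) (g : R -> R) (x l : R) :
  is_derive x 1 g l -> h^-1 * (g (x + h) - g x) @[h --> 0^'] --> l.
Proof.
move=> [dg <-].
have -> : (fun h => h^-1 * (g (x + h) - g x)) =
    (fun h => h^-1 *: ((g \o shift x) (h *: 1) - g x)).
  by apply/funext => h; rewrite /= [h *: 1]mulr1 (addrC x).
exact: dg.
Qed.

Lemma is_derive_left (R : realType) (g : R -> R) (x l : R) :
  is_derive x 1 g l -> left_derivative g x l.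
Proof. by move=> /is_derive1_cvg/cvg_dnbhs_at_left. Qed.

Lemma is_derive_right (R : realType) (g : R -> R) (x l : R) :
  is_derive x 1 g l -> right_derivative g x l.
Proof. by move=> /is_derive1_cvg/cvg_dnbhs_at_right. Qed.

(** For small negative increments both difference quotients use only points of [[a, x]], so they
    coincide and limits are unique. This carries the transmission condition over to the closed form,
    which is known only on the closed subinterval. *)
Lemma left_derivative_uniq (R : realType) (g h : R -> R) (a x l m : R) :
  a < x -> (forall t, a <= t <= x -> g t = h t) ->
  left_derivative g x l -> is_derive x 1 h m -> l = m.
Proof.
move=> ax gh gl /is_derive_left hm.
apply: (cvg_unique (@Rhausdorff R)) hm; apply: cvg_trans gl.
apply: near_eq_cvg; near=> e.
have e0 : e < 0 by near: e; exact: nbhs_left_lt.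
have ea : a - x < e by near: e; apply: nbhs_left_gt; rewrite subr_lt0.
by rewrite !gh ?lexx ?ltW//=; lra.
Unshelve. all: by end_near. Qed.

Lemma right_derivative_uniq (R : realType) (g h : R -> R) (b x l m : R) :
  x < b -> (forall t, x <= t <= b -> g t = h t) ->
  right_derivative g x l -> is_derive x 1 h m -> l = m.
Proof.
move=> xb gh gl /is_derive_right hm.
apply: (cvg_unique (@Rhausdorff R)) hm; apply: cvg_trans gl.
apply: near_eq_cvg; near=> e.
have e0 : 0 < e by near: e; exact: nbhs_right_gt.
have eb : e < b - x by near: e; apply: nbhs_right_lt; rewrite subr_gt0.
by rewrite !gh ?lexx ?ltW//=; lra.
Unshelve. all: by end_near. Qed.

(* E, H = e^(s alpha), e^(-s alpha), and G = e^(s (2T - alpha)); the factor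
   (s - d) (s + d) is 1/nu. *)
Definition interface_ratio (R : realType) (d s alpha T : R) : R :=
  let E := expR (s * alpha) in let H := expR (- s * alpha) in
  let G := expR (s * T) ^+ 2 * H in
  (s - d) * (s + d) * (E - H) * (E + G) /
  (((s + d) * E - (s - d) * H) * ((s - d) * E + (s + d) * G)).

(** * The factor of one iteration and its bounds *)

Section interface_ratio_theory.
Context {R : realType} {d s alpha T : R}.
Hypotheses (d_gt0 : 0 < d) (lt_ds : d < s) (alpha_bounds : 0 < alpha < T).

Let E := expR (s * alpha).
Let H := expR (- s * alpha).
Let G := expR (s * T) ^+ 2 * H.

Lemma interface_ratio_signs :
  [/\ 0 < H, H < E, E < G, 0 < (s + d) * E - (s - d) * H &
      0 < (s - d) * E + (s + d) * G].
Proof.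
have /andP[a0 aT] := alpha_bounds.
have s0 : 0 < s by exact: lt_trans lt_ds.
have sa : 0 < s * alpha by rewrite mulr_gt0.
have saT : s * alpha < s * T by rewrite ltr_pM2l.
have H0 : 0 < H by exact: expR_gt0.
have HE : H < E by rewrite /H /E ltr_expR mulNr; lra.
have EG : E < G.
  by rewrite /G /H /E expr2 -!expRD ltr_expR mulNr; lra.
split=> //.
  (* Rewritten as a sum of positive terms. *)
  have -> : (s + d) * E - (s - d) * H = (s - d) * (E - H) + 2 * d * E by ring.
  by rewrite addr_gt0 ?mulr_gt0 ?expR_gt0 ?subr_gt0.
by rewrite addr_gt0 ?mulr_gt0 ?exprn_gt0 ?expR_gt0 ?subr_gt0 ?addr_gt0.
Qed.

Lemma interface_ratio_bounds : 0 <= interface_ratio d s alpha T < 1.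
Proof.
have [H0 HE EG D1 D2] := interface_ratio_signs.
rewrite /interface_ratio -/E -/H -/G.
have d0 := d_gt0; have sd : 0 < s - d by rewrite subr_gt0.
apply/andP; split.
  apply: divr_ge0; last by rewrite mulr_ge0 ?ltW.
  by rewrite !mulr_ge0//; lra.
rewrite ltr_pdivrMr ?mulr_gt0// mul1r -subr_gt0.
(* Denominator minus numerator has the factor [d], so the strict bound rests on [d > 0]. *)
have -> : ((s + d) * E - (s - d) * H) * ((s - d) * E + (s + d) * G) -
  (s - d) * (s + d) * (E - H) * (E + G) =
  2 * d * E * ((s + d) * G + (s - d) * H) by ring.
have [E0 G0 sd'] : [/\ 0 < E, 0 < G & 0 < s + d] by split; lra.
by rewrite !mulr_gt0// addr_gt0//; exact: mulr_gt0.
Qed.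

(** The boundary and transmission conditions form a linear system for the four constants, uniquely
    solvable because both denominators of the ratio are positive. The converse direction provides
    the solvability of the subproblems. *)
Lemma nd1_stepP (nu theta f f' : R) : s ^+ 2 = d ^+ 2 + nu^-1 ->
  nd1_step nu 0 T alpha theta d f f' <->
  f' = (1 - theta + theta * interface_ratio d s alpha T) * f.
Proof.
move=> sE; have [d0 ds] : 0 < d /\ d < s by [].
have [H0 HE EG D1 D2] := interface_ratio_signs.
have /andP[a0 aT] := alpha_bounds.
have s0 : s != 0 by lra.
have sd0 : s - d != 0 by lra.
have sd1 : s + d != 0 by lra.
set D1' := (_ * E - _ * H) in D1; set D2' := (_ * E + _ * G) in D2.
set F := expR (s * T).
have F0 : 0 < F by exact: expR_gt0.
have FV : expR (- s * T) = F^-1 by rewrite mulNr expRN.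
split.
  move=> [z1 [mu1 [z2 [mu2 [ [sol2 z2a m2T] [sol1 z10 [l [ll lr]]] ->]]]]].
  have [c1 [c2 h2]] := optimality_system_sol s0 sE sol2.
  have [e1 [e2 h1]] := optimality_system_sol s0 sE sol1.
  have eqll : l = costate s (s * e1) (- s * e2) alpha.
    apply: (left_derivative_uniq a0 _ ll (is_derive_costate _ _ _ _)).
    by move=> t /h1[].
  have eqlr : l = costate s (s * c1) (- s * c2) alpha.
    apply: (right_derivative_uniq aT _ lr (is_derive_costate _ _ _ _)).
    by move=> t /h2[].
  have [z2a' _] := h2 alpha ltac:(by rewrite lexx ltW).
  have [_ m2T'] := h2 T ltac:(by rewrite lexx ltW).
  have [z10' _] := h1 0 ltac:(by rewrite lexx ltW).
  have [z1a _] := h1 alpha ltac:(by rewrite lexx ltW).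
  move: m2T; rewrite mul0r addr0 m2T' /costate FV -/F => c12.
  move: z10; rewrite z10' /state !mulr0 expR0 !mulr1 => e12.
  (* With [gamma = 0] the terminal condition is [mu2 T = 0]. Then [- c2 * H = c1 * G], which is how
     [G] enters. *)
  have c2E : c2 = - c1 * F ^+ 2.
    have -> : c2 = (c1 * F + c2 / F) * F - c1 * F ^+ 2 by field; lra.
    by rewrite c12; ring.
  have fE : f = c1 * D2'.
    by rewrite -z2a z2a' /state -/E -/H c2E /D2' /G -/F; ring.
  have qE : e2 = e1 * (s - d) / (s + d).
    by move/eqP: e12; rewrite subr_eq0 => /eqP ->; rewrite mulfK.
  (* The transmission condition: [l] is computed from both sides of the interface, with the
     denominator [s + d] cleared. *)
  have e1E : e1 * D1' = (s + d) * c1 * (E + G).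
    apply: (mulfI s0).
    have -> : s * ((s + d) * c1 * (E + G)) = (s + d) * l.
      by rewrite eqlr /costate -/E -/H c2E /G -/F; ring.
    by rewrite eqll /costate -/E -/H qE /D1'; field.
  have z1E : z1 alpha = e1 * (s - d) * (E - H).
    by rewrite z1a /state -/E -/H qE; field.
  rewrite z1E /interface_ratio -/E -/H -/G fE [RHS]mulrDl; congr (_ + _).
  have -> : e1 = (s + d) * c1 * (E + G) / D1' by rewrite -e1E mulfK//; lra.
  by rewrite -/D1' -/D2'; field; apply/andP; split; lra.
move=> ->.
(* The values forced in the first direction, now taken as definitions. *)
pose c1 := f / D2'; pose c2 : R := - c1 * F ^+ 2.
pose e1 := (s + d) * c1 * (E + G) / D1'; pose e2 := e1 * (s - d) / (s + d).
exists (state d s e1 e2), (costate s e1 e2),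
  (state d s c1 c2), (costate s c1 c2).
split; [split|split|].
- exact: optimality_system_state.
- rewrite -[RHS](divfK (lt0r_neq0 D2)) -/c1 /state -/E -/H /c2 /D2' /G -/F.
  by ring.
- rewrite mul0r addr0 /costate FV -/F /c2; field; lra.
- exact: optimality_system_state.
- by rewrite /state !mulr0 expR0 !mulr1 /e2; field.
- exists (costate s (s * c1) (- s * c2) alpha); split; last first.
    exact/is_derive_right/is_derive_costate.
  have -> : costate s (s * c1) (- s * c2) alpha =
      costate s (s * e1) (- s * e2) alpha.
    rewrite /costate -/E -/H.
    have -> : s * e1 * E + - s * e2 * H = s * e1 * D1' / (s + d).
      by rewrite /e2 /D1'; field.
    by rewrite /c2 /e1 /G -/F; field; apply/andP; split; lra.
  exact/is_derive_left/is_derive_costate.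
- rewrite /interface_ratio -/E -/H -/G -/D1' -/D2' mulrDl; congr (_ + _).
  rewrite /state -/E -/H /e2 /e1 /c1; field.
  by apply/and3P; split; lra.
Qed.

End interface_ratio_theory.

(* d_nneg: A stands for a semi-discretization of the nonnegative operator
   - Laplacian; with a negative eigenvalue the claim can fail. *)
Theorem theorem4 (R : realType) (n : nat) (A P : 'M[R]_n) (d : 'rV[R]_n)
    (nu gamma T alpha theta : R)
    (P_unit : P \in unitmx)
    (A_diag : A = P *m diag_mx d *m invmx P)
    (d_nneg : forall i : 'I_n, 0 <= d 0 i)
    (nu_gt0 : 0 < nu)
    (gamma_ge0 : 0 <= gamma)
    (T_gt0 : 0 < T)
    (alpha_bounds : 0 < alpha < T)
    (theta_bounds : 0 < theta < 1)
    (gamma_eq0 : gamma = 0)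
    (A_nonsingular : A \in unitmx) :
  nd1_converges nu gamma T alpha theta d.
Proof.
have d_gt0 i : 0 < d 0 i.
  rewrite lt_neqAle d_nneg andbT eq_sym.
  move: A_nonsingular; rewrite A_diag !unitmx_mul => /andP[/andP[_ +] _].
  by rewrite unitmxE det_diag unitfE => /prodf_neq0/(_ i); apply.
have nuV0 : 0 < nu^-1 by rewrite invr_gt0.
pose s i := Num.sqrt (d 0 i ^+ 2 + nu^-1).
have sE i : s i ^+ 2 = d 0 i ^+ 2 + nu^-1.
  by rewrite sqr_sqrtr// addr_ge0 ?sqr_ge0// ltW.
have d_lt_s i : d 0 i < s i.
  rewrite -(@ltr_pXn2r _ 2)// ?nnegrE ?sqrtr_ge0 ?d_nneg//.
  by rewrite sE ltrDl.
pose rho i := 1 - theta + theta * interface_ratio (d 0 i) (s i) alpha T.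
have step i f f' : nd1_step nu gamma T alpha theta (d 0 i) f f' <->
    f' = rho i * f.
  by rewrite gamma_eq0; exact: nd1_stepP.
(* [rho i] is a convex combination of 1 and a ratio in [[0, 1)] with weight [theta > 0] on the
   latter, so it lies in [[1 - theta, 1)]. *)
have rho_lt1 i : `|rho i| < 1.
  have /andP[r0 r1] := interface_ratio_bounds (d_gt0 i) (d_lt_s i) alpha_bounds.
  have /andP[t0 t1] := theta_bounds.
  by rewrite /rho ltr_norml; apply/andP; split; nra.
(* [step] serves in both directions: the geometric sequence is a run, and every run is that
   sequence. *)
move=> f0; split.
  exists (fun k => \row_i (rho i ^+ k * f0 0 i)); split.
    by apply/rowP => i; rewrite mxE expr0 mul1r.
  by move=> k i; apply/step; rewrite !mxE exprS mulrA.
move=> f [f_0 fS] i.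
have -> : (fun k => f k 0 i) = geometric (f0 0 i) (rho i).
  apply/funext => k; elim: k => [|k IH]; first by rewrite /= f_0 expr0 mulr1.
  by have /step -> := fS k i; rewrite IH /= exprS; ring.
exact: cvg_geometric.
Qed.
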